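(* Let $(X,\mu)$ be a group chunk on a site $\mathcal C$. Then for any object $T\in\mathcal C$, any integer $n>0$ and any partial morphisms $\phi_1,\dots,\phi_n\in\widetilde X^{(\infty)}(T)$, the intersection $\bigcap_{i=1}^n\operatorname{dom}\phi_i$ is locally nontrivial.
   Context: Sites are small. A partial morphism $\phi\colon X\dashrightarrow Y$ is a subobject $\operatorname{dom}\phi\hookrightarrow X$ with a morphism $\operatorname{dom}\phi\to Y$; $\psi\circ\phi$ has as domain the preimage of $\operatorname{dom}\psi$ under $\phi$. A presheaf of partial magmas $(X,\mu)$ is a presheaf $X$ with a partial morphism $\mu\colon X\times X\dashrightarrow X$. Let $\Gamma_\mu\subset X^3$ be the graph of $\mu$. $\mu$ is cancellative if for all $i<j$ in $\{1,2,3\}$ the projection $\Gamma_\mu\to X_i\times X_j$ (with $X_i=X$) is a monomorphism; then $\Gamma_\mu$ is the graph of a partial morphism $\mu_{ij}\colon X_i\times X_j\dashrightarrow X_k$, and $\mu=\mu_{12}$. A cancellative $\mu$ is strongly associative if, whenever both sides are defined on sections, $\mu(x_1,\mu(x_2,x_3))=\mu(\mu(x_1,x_2),x_3)$ and $\mu_{13}(x_1,\mu(x_2,x_3))=\mu(\mu_{13}(x_1,x_2),x_3)$. For $T\in\mathcal C$, $X_T$ is the presheaf $(T'\to T)\mapsto X(T')$ on the slice category $\mathcal C_T$. For $x\in X(T)$, $\lambda_x,\lambda_x^\dagger\colon X_T\dashrightarrow X_T$ are the partial morphisms $z\in X(T')\mapsto\mu(x|_{T'},z)$ and $z\mapsto\mu_{13}(x|_{T'},z)$,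 defined where the right-hand sides are. $\widetilde X(T)$ is the set of partial morphisms of the form $\lambda_x$ or $\lambda_x^\dagger$, $x\in X(T)$; $\widetilde X^{(\infty)}(T)$ is the set of finite nonempty compositions of elements of $\widetilde X(T)$. A subpresheaf $F\subset X_T$ is locally nontrivial if there is a covering sieve $S$ of $T$ with $F(T'\to T)\ne\emptyset$ for every $T'\to T$ in $S$. $\mu$ has large domain if for all $T$, $N>0$ and $\alpha_1,\dots,\alpha_N,\beta_1,\dots,\beta_N\in\widetilde X(T)$ the intersection $\bigcap_i\operatorname{dom}(\alpha_i\circ\beta_i)$ is locally nontrivial. A group chunk is a presheaf of partial magmas that is separated, cancellative, strongly associative and has large domain. *)

(* Defs.v *)
From mathcomp Require Import all_boot.
From mathcomp Require Import boolp.

Set Implicit Arguments.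
Unset Strict Implicit.
Unset Printing Implicit Defensive.

Local Obligation Tactic := idtac.

Record category := Category {
  obj :> Type;
  hom : obj -> obj -> Type;
  idm : forall A, hom A A;
  compm : forall A B C, hom B C -> hom A B -> hom A C;
  comp_idl : forall A B (f : hom A B), compm (idm B) f = f;
  comp_idr : forall A B (f : hom A B), compm f (idm A) = f;
  comp_assoc : forall A B C D (h : hom C D) (g : hom B C) (f : hom A B),
    compm h (compm g f) = compm (compm h g) f }.
Arguments idm {c} A.
Arguments compm {c A B C} g f.

Record sieve (C : category) (T : C) := Sieve {
  in_sieve :> forall T' : C, hom T' T -> Prop;
  sieve_comp : forall (T' T'' : C) (f : hom T' T) (g : hom T'' T'),
    in_sieve f -> in_sieve (compm f g) }.

Definition max_sieve (C : category) (T : C) : sieve T :=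
  @Sieve C T (fun _ _ => True) (fun _ _ _ _ _ => I).

Program Definition pull_sieve (C : category) (T U : C) (f : hom U T)
    (S : sieve T) : sieve U :=
  @Sieve C U (fun _ g => S _ (compm f g)) _.
Next Obligation.
by move=> C T U f S T' T'' g h /= ?; rewrite comp_assoc; apply: sieve_comp.
Qed.

Record site := Site {
  site_cat :> category;
  covering : forall T : site_cat, sieve T -> Prop;
  covering_max : forall T : site_cat, covering (max_sieve T);
  covering_pull : forall (T U : site_cat) (f : hom U T) (S : sieve T),
    covering S -> covering (pull_sieve f S);
  covering_trans : forall (T : site_cat) (S R : sieve T),
    covering S ->
    (forall (U : site_cat) (f : hom U T), S U f -> covering (pull_sieve f R)) ->
    covering R }.

Section Slice.
Variables (C : category) (T : C).

Definition slice_obj : Type := {T' : C & hom T' T}.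

Definition slice_mk (T' : C) (f : hom T' T) : slice_obj := existT _ T' f.

Definition slice_hom (a b : slice_obj) : Type :=
  {h : hom (projT1 a) (projT1 b) | compm (projT2 b) h = projT2 a}.

Lemma slice_hom_eq (a b : slice_obj) (h k : slice_hom a b) :
  sval h = sval k -> h = k.
Proof.
case: h k => [h hh] [k kk] /= e; subst k; congr exist; exact: Prop_irrelevance.
Qed.

Definition slice_id (a : slice_obj) : slice_hom a a :=
  exist _ (idm (projT1 a)) (comp_idr (projT2 a)).

Program Definition slice_comp (a b c : slice_obj)
    (g : slice_hom b c) (f : slice_hom a b) : slice_hom a c :=
  exist _ (compm (sval g) (sval f)) _.
Next Obligation.
by move=> a b c [g /= hg] [f /= hf]; rewrite comp_assoc hg hf.
Qed.

Program Definition slice : category :=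
  @Category slice_obj slice_hom slice_id slice_comp _ _ _.
Next Obligation. by move=> *; apply: slice_hom_eq; exact: comp_idl. Qed.
Next Obligation. by move=> *; apply: slice_hom_eq; exact: comp_idr. Qed.
Next Obligation. by move=> *; apply: slice_hom_eq; exact: comp_assoc. Qed.

End Slice.

Record presheaf (C : category) := Presheaf {
  sec :> C -> Type;
  res : forall (T U : C), hom U T -> sec T -> sec U;
  res_id : forall (T : C) (x : sec T), res (idm T) x = x;
  res_comp : forall (T U V : C) (f : hom U T) (g : hom V U) (x : sec T),
    res (compm f g) x = res g (res f x) }.
Arguments res {C p T U} f x.

Record psh_hom (C : category) (X Y : presheaf C) := PshHom {
  app :> forall T : C, X T -> Y T;
  app_res : forall (T U : C) (f : hom U T) (x : X T),
    app (res f x) = res f (app x) }.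
Arguments app {C X Y} p {T} x.

Lemma psh_hom_eq (C : category) (X Y : presheaf C) (f g : psh_hom X Y) :
  (forall (T : C) (x : X T), app f x = app g x) -> f = g.
Proof.
case: f g => [f hf] [g hg] /= e.
have {}e : f = g.
  by apply: functional_extensionality_dep => T; apply: funext => x.
subst g; congr PshHom; exact: Prop_irrelevance.
Qed.

Program Definition psh_comp (C : category) (X Y Z : presheaf C)
    (g : psh_hom Y Z) (f : psh_hom X Y) : psh_hom X Z :=
  @PshHom C X Z (fun _ x => app g (app f x)) _.
Next Obligation. by move=> * /=; rewrite !app_res. Qed.

Definition monomorphism (C : category) (X Y : presheaf C)
    (f : psh_hom X Y) : Prop :=
  forall (W : presheaf C) (g h : psh_hom W X),
    psh_comp f g = psh_comp f h -> g = h.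

Program Definition prod_psh (C : category) (X Y : presheaf C) : presheaf C :=
  @Presheaf C (fun T => (X T * Y T)%type)
    (fun _ _ f z => (res f z.1, res f z.2)) _ _.
Next Obligation. by move=> C X Y T [x y]; rewrite !res_id. Qed.
Next Obligation. by move=> * /=; rewrite !res_comp. Qed.

Program Definition restrict (C : category) (X : presheaf C) (T : C) :
    presheaf (slice T) :=
  @Presheaf (slice T) (fun a : slice T => X (projT1 a))
    (fun _ _ h x => res (sval h) x) _ _.
Next Obligation. by move=> *; exact: res_id. Qed.
Next Obligation. by move=> *; exact: res_comp. Qed.

(** Every subobject of a presheaf has a unique subpresheaf representing it,
    so subobjects are encoded as subpresheaves. *)
Record subpsh (C : category) (X : presheaf C) := Subpsh {
  insub_psh :> forall T : C, X T -> Prop;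
  insub_res : forall (T U : C) (f : hom U T) (x : X T),
    insub_psh x -> insub_psh (res f x) }.
Arguments insub_psh {C X} s {T} x.

Section Subpresheaf.
Variables (C : category) (X : presheaf C).

Definition sub_sec (F : subpsh X) (T : C) : Type := {x : X T | insub_psh F x}.

Lemma sub_sec_eq (F : subpsh X) (T : C) (x y : sub_sec F T) :
  sval x = sval y -> x = y.
Proof.
case: x y => [x hx] [y hy] /= e; subst y; congr exist; exact: Prop_irrelevance.
Qed.

Program Definition psh_of_sub (F : subpsh X) : presheaf C :=
  @Presheaf C (sub_sec F)
    (fun _ _ f x => exist _ (res f (sval x)) (insub_res f (svalP x))) _ _.
Next Obligation. by move=> *; apply: sub_sec_eq; exact: res_id. Qed.
Next Obligation. by move=> *; apply: sub_sec_eq; exact: res_comp. Qed.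

Definition sub_incl (F : subpsh X) : psh_hom (psh_of_sub F) X :=
  @PshHom C (psh_of_sub F) X (fun _ x => sval x) (fun _ _ _ _ => erefl).

Program Definition sub_bigcap (I : Type) (F : I -> subpsh X) : subpsh X :=
  @Subpsh C X (fun _ x => forall i, insub_psh (F i) x) _.
Next Obligation. by move=> I F T U f x h i; apply: insub_res. Qed.

End Subpresheaf.

Lemma mono_inj (C : category) (X Y : presheaf C) (f : psh_hom X Y) :
  monomorphism f -> forall (T : C) (x y : X T), app f x = app f y -> x = y.
Proof.
move=> mf T x y e.
have stab (U V : C) (u : hom V U) (z : prod_psh X X U) :
  app f z.1 = app f z.2 -> app f (res u z).1 = app f (res u z).2.
  by move=> /= ez; rewrite !app_res ez.
pose K := @Subpsh C (prod_psh X X) (fun U z => app f z.1 = app f z.2) stab.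
pose p1 : psh_hom (psh_of_sub K) X :=
  @PshHom C (psh_of_sub K) X (fun _ z => (sval z).1) (fun _ _ _ _ => erefl).
pose p2 : psh_hom (psh_of_sub K) X :=
  @PshHom C (psh_of_sub K) X (fun _ z => (sval z).2) (fun _ _ _ _ => erefl).
have e12 : p1 = p2 by apply: mf; apply: psh_hom_eq => U [z hz].
pose w : psh_of_sub K T := exist _ (x, y) e.
exact: (congr1 (fun p : psh_hom (psh_of_sub K) X => app p w) e12).
Qed.

Record pmorph (C : category) (X Y : presheaf C) := Pmorph {
  pdom : subpsh X;
  pmor : psh_hom (psh_of_sub pdom) Y }.

Section PartialMorphisms.
Variables (C : category).

Definition pval (X Y : presheaf C) (phi : pmorph X Y) (T : C) (x : X T)
    (h : insub_psh (pdom phi) x) : Y T :=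
  app (pmor phi) (exist _ x h : psh_of_sub (pdom phi) T).
Arguments pval {X Y} phi {T x} h.

Lemma pval_irr (X Y : presheaf C) (phi : pmorph X Y) (T : C) (x y : X T)
    (hx : insub_psh (pdom phi) x) (hy : insub_psh (pdom phi) y) :
  x = y -> pval phi hx = pval phi hy.
Proof. by move=> e; congr (app (pmor phi) _); apply: sub_sec_eq. Qed.

Lemma pval_res (X Y : presheaf C) (phi : pmorph X Y) (T U : C) (f : hom U T)
    (x : X T) (h : insub_psh (pdom phi) x)
    (hf : insub_psh (pdom phi) (res f x)) :
  pval phi hf = res f (pval phi h).
Proof. by rewrite /pval -app_res; congr (app _ _); apply: sub_sec_eq. Qed.

Program Definition pmorph_comp_dom (X Y Z : presheaf C)
    (psi : pmorph Y Z) (phi : pmorph X Y) : subpsh X :=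
  @Subpsh C X (fun _ x => exists h : insub_psh (pdom phi) x,
                 insub_psh (pdom psi) (pval phi h)) _.
Next Obligation.
move=> X Y Z psi phi T U f x [h k]; exists (insub_res f h).
by rewrite (pval_res h); apply: insub_res.
Qed.

Program Definition pmorph_comp (X Y Z : presheaf C)
    (psi : pmorph Y Z) (phi : pmorph X Y) : pmorph X Z :=
  @Pmorph C X Z (pmorph_comp_dom psi phi)
    (@PshHom C (psh_of_sub (pmorph_comp_dom psi phi)) Z
       (fun _ x => pval psi (ex_proj2 (svalP x))) _).
Next Obligation.
move=> X Y Z psi phi T U f [x hx].
set k := svalP _; set l := svalP _.
rewrite -(pval_res (ex_proj2 l) (insub_res f (ex_proj2 l))).
by apply: pval_irr; exact: pval_res.
Qed.

Program Definition graph (X Y : presheaf C) (phi : pmorph X Y) :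
    subpsh (prod_psh X Y) :=
  @Subpsh C (prod_psh X Y)
    (fun _ z => exists h : insub_psh (pdom phi) z.1, pval phi h = z.2) _.
Next Obligation.
move=> X Y phi T U f [x y] /= [h <-]; exists (insub_res f h); exact: pval_res.
Qed.

(** A monomorphism [p : G -> X] and a morphism [q : G -> Y] define a partial
    morphism from [X] to [Y]: its domain is the subobject of [X] given by [p],
    that is, the image of [p], and its value at [p g] is [q g]. *)
Program Definition span_dom (G X : presheaf C) (p : psh_hom G X) : subpsh X :=
  @Subpsh C X (fun T x => exists g : G T, app p g = x) _.
Next Obligation.
by move=> G X p T U f x [g <-]; exists (res f g); rewrite app_res.
Qed.

Program Definition span_pmorph (G X Y : presheaf C) (p : psh_hom G X)
    (q : psh_hom G Y) (hp : monomorphism p) : pmorph X Y :=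
  @Pmorph C X Y (span_dom p)
    (@PshHom C (psh_of_sub (span_dom p)) Y
       (fun _ x => app q (projT1 (cid (svalP x)))) _).
Next Obligation.
move=> G X Y p q hp T U f [x hx] /=.
set k := cid _; set l := cid _; case: k l => [g hg] [g' hg'] /=.
rewrite -app_res; congr (app q _); apply: (mono_inj hp).
by rewrite app_res hg hg'.
Qed.

End PartialMorphisms.
Arguments pval {C X Y} phi {T x} h.

Section Magma.
Variables (C : category) (X : presheaf C) (mu : pmorph (prod_psh X X) X).

(** [X^3] is [(X * X) * X], so the graph of [mu] is a subpresheaf of it. *)
Definition pr12 : psh_hom (prod_psh (prod_psh X X) X) (prod_psh X X) :=
  @PshHom C (prod_psh (prod_psh X X) X) (prod_psh X X)
    (fun _ z => (z.1.1, z.1.2)) (fun _ _ _ _ => erefl).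
Definition pr13 : psh_hom (prod_psh (prod_psh X X) X) (prod_psh X X) :=
  @PshHom C (prod_psh (prod_psh X X) X) (prod_psh X X)
    (fun _ z => (z.1.1, z.2)) (fun _ _ _ _ => erefl).
Definition pr23 : psh_hom (prod_psh (prod_psh X X) X) (prod_psh X X) :=
  @PshHom C (prod_psh (prod_psh X X) X) (prod_psh X X)
    (fun _ z => (z.1.2, z.2)) (fun _ _ _ _ => erefl).
Definition pr2 : psh_hom (prod_psh (prod_psh X X) X) X :=
  @PshHom C (prod_psh (prod_psh X X) X) X
    (fun _ z => z.1.2) (fun _ _ _ _ => erefl).

Record cancellative : Prop := Cancellative {
  cancel12 : monomorphism (psh_comp pr12 (sub_incl (graph mu)));
  cancel13 : monomorphism (psh_comp pr13 (sub_incl (graph mu)));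
  cancel23 : monomorphism (psh_comp pr23 (sub_incl (graph mu))) }.

Definition mu13 (hc : cancellative) : pmorph (prod_psh X X) X :=
  span_pmorph (psh_comp pr2 (sub_incl (graph mu))) (cancel13 hc).

Lemma graph_mu13 (hc : cancellative) (T : C) (x y z : X T) :
  insub_psh (graph (mu13 hc)) ((x, z, y) : prod_psh (prod_psh X X) X T) <->
  insub_psh (graph mu) ((x, y, z) : prod_psh (prod_psh X X) X T).
Proof.
split=> [[/= h]|hg].
  by rewrite /pval /=; case: cid => -[[[a b] c] hg] /= [<- <-] <-.
have h : insub_psh (pdom (mu13 hc)) ((x, z) : prod_psh X X T).
  by exists (exist _ ((x, y), z) hg).
exists h; rewrite /pval /=; case: cid => g /= eg.
have -> // : g = exist _ ((x, y), z) hg.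
by apply: (mono_inj (cancel13 hc)).
Qed.

Record strongly_associative (hc : cancellative) : Prop :=
  StronglyAssociative {
  assoc_mu : forall (T : C) (x1 x2 x3 : X T)
    (h23 : insub_psh (pdom mu) ((x2, x3) : prod_psh X X T))
    (hl : insub_psh (pdom mu) ((x1, pval mu h23) : prod_psh X X T))
    (h12 : insub_psh (pdom mu) ((x1, x2) : prod_psh X X T))
    (hr : insub_psh (pdom mu) ((pval mu h12, x3) : prod_psh X X T)),
    pval mu hl = pval mu hr;
  assoc_mu13 : forall (T : C) (x1 x2 x3 : X T)
    (h23 : insub_psh (pdom mu) ((x2, x3) : prod_psh X X T))
    (hl : insub_psh (pdom (mu13 hc)) ((x1, pval mu h23) : prod_psh X X T))
    (h12 : insub_psh (pdom (mu13 hc)) ((x1, x2) : prod_psh X X T))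
    (hr : insub_psh (pdom mu) ((pval (mu13 hc) h12, x3) : prod_psh X X T)),
    pval (mu13 hc) hl = pval mu hr }.

End Magma.

Section Translation.
Variables (C : category) (X : presheaf C) (nu : pmorph (prod_psh X X) X).
Variables (T : C) (x : X T).

(** At an object [a : T' -> T] of the slice category, [res (projT2 a) x] is the
    restriction of [x] to [T']. *)
Program Definition ltrans_dom : subpsh (restrict X T) :=
  @Subpsh (slice T) (restrict X T)
    (fun (a : slice T) (z : X (projT1 a)) =>
       insub_psh (pdom nu)
         ((res (projT2 a) x, z) : prod_psh X X (projT1 a))) _.
Next Obligation.
move=> [T' f] [T'' g] [h e] z hz; move: (e) => /= <-.
by rewrite res_comp; apply: (insub_res h hz).
Qed.

Program Definition ltrans : pmorph (restrict X T) (restrict X T) :=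
  @Pmorph (slice T) (restrict X T) (restrict X T) ltrans_dom
    (@PshHom (slice T) (psh_of_sub ltrans_dom) (restrict X T)
       (fun (a : slice T) z => pval nu (svalP z)) _).
Next Obligation.
move=> a b h z.
refine (eq_trans _ (pval_res (svalP z) (insub_res (sval h) (svalP z)))).
by apply: pval_irr => /=; rewrite -res_comp (svalP h).
Qed.

End Translation.

Section TildeX.
Variables (C : category) (X : presheaf C) (mu : pmorph (prod_psh X X) X).
Variables (hc : cancellative mu) (T : C).

Definition lambda (x : X T) : pmorph (restrict X T) (restrict X T) :=
  ltrans mu x.

Definition lambda_dag (x : X T) : pmorph (restrict X T) (restrict X T) :=
  ltrans (mu13 hc) x.

Definition tildeX (phi : pmorph (restrict X T) (restrict X T)) : Prop :=
  exists x : X T, phi = lambda x \/ phi = lambda_dag x.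

(** Compositions with arbitrary bracketing. *)
Inductive tildeX_inf : pmorph (restrict X T) (restrict X T) -> Prop :=
| tildeX_inf_one phi : tildeX phi -> tildeX_inf phi
| tildeX_inf_comp psi phi :
    tildeX_inf psi -> tildeX_inf phi -> tildeX_inf (pmorph_comp psi phi).

End TildeX.

Section GroupChunk.
Variables (C : site) (X : presheaf C).

Definition separated : Prop :=
  forall (T : C) (S : sieve T), covering S ->
  forall x y : X T,
    (forall (T' : C) (f : hom T' T), S T' f -> res f x = res f y) -> x = y.

Definition locally_nontrivial (T : C) (F : subpsh (restrict X T)) : Prop :=
  exists2 S : sieve T, covering S &
    forall (T' : C) (f : hom T' T), S T' f ->
      exists z : restrict X T (slice_mk f), insub_psh F z.

Variable mu : pmorph (prod_psh X X) X.

Definition large_domain (hc : cancellative mu) : Prop :=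
  forall (T : C) (N : nat), 0 < N ->
  forall alpha beta : 'I_N -> pmorph (restrict X T) (restrict X T),
    (forall i, tildeX hc (alpha i)) -> (forall i, tildeX hc (beta i)) ->
    locally_nontrivial
      (sub_bigcap (fun i => pdom (pmorph_comp (alpha i) (beta i)))).

Record group_chunk : Prop := GroupChunk {
  gc_separated : separated;
  gc_cancellative : cancellative mu;
  gc_assoc : strongly_associative gc_cancellative;
  gc_large : large_domain gc_cancellative }.

End GroupChunk.

(* Main.v *)
Require Import Defs.
From mathcomp Require Import all_boot.
From mathcomp Require Import boolp.

Set Implicit Arguments.
Unset Strict Implicit.
Unset Printing Implicit Defensive.

(** Write [x z] for [mu (x, z)] and let a word be a composition of translations
    [lambda_x] and [lambda_x^dagger].  The proof is an induction on the length
    of the words.  Suppose that [q] lies in the domain of a word deprived of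
    its outermost letter, and follow [q z] instead of [q] through the word: as
    long as everything is defined, strong associativity says that
    [alpha (q z) = (alpha q) z] for each letter [alpha], so the running value
    is [r z], where [r] is the value reached from [q].  Hence [q z] lies in the
    domain of the whole word as soon as [z] lies in the domains of the
    compositions [alpha o lambda_r], for each letter [alpha] and the value [r]
    reached just before it.  There are finitely many of these, each of length
    two, so large domain provides such a [z] locally ([largely_run],
    [largely_locally]).  The section [q] is provided, locally and for all the
    words at once, by the induction hypothesis; composing the two covers
    ([locally_bind]) gives the next length ([locally_runs]). *)

(** * Local existence of sections *)

Lemma sieve_eq (C : category) (T : C) (S R : sieve T) :
  (forall U (f : hom U T), S U f <-> R U f) -> S = R.
Proof.
case: S R => [S hS] [R hR] /= e.
have {}e : S = R.
  by apply: functional_extensionality_dep => U; apply: funext => f; apply: propext.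
subst R; congr Sieve; exact: Prop_irrelevance.
Qed.

Lemma covering_sub (C : site) (T : C) (S R : sieve T) :
  covering S -> (forall U (f : hom U T), S U f -> R U f) -> covering R.
Proof.
move=> cS sSR; apply: (covering_trans cS) => U f /sSR Rf.
have -> : pull_sieve f R = max_sieve U; last exact: covering_max.
by apply: sieve_eq => V g; split=> // _; apply: sieve_comp.
Qed.

Section Locally.
Variables (C : site) (X : presheaf C).

(** Local nontriviality for arbitrary families of predicates: conditions on [z]
    that mention a section [q] chosen over each object of a cover need not
    define a subpresheaf, as the choices are not compatible with restriction. *)
Definition locally (T : C) (P : forall U, hom U T -> X U -> Prop) : Prop :=
  exists2 S : sieve T, covering S &
    forall U (f : hom U T), S U f -> exists z, P U f z.

Lemma locallyW (T : C) (P Q : forall U, hom U T -> X U -> Prop) :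
  (forall U f z, P U f z -> exists y, Q U f y) -> locally P -> locally Q.
Proof.
by move=> PQ [S cS hS]; exists S => // U f /hS[z /PQ].
Qed.

Lemma locally_bind (T : C) (P Q : forall U, hom U T -> X U -> Prop) :
  locally P ->
  (forall U (f : hom U T) q, P U f q ->
     locally (fun V (g : hom V U) z => Q V (compm f g) z)) ->
  locally Q.
Proof.
move=> [S cS hS] PQ.
(* The covering sieve consists of the [h] such that [Q] is satisfied over every
   restriction of [h]; this is a sieve whatever [Q] is. *)
have Rcomp V W (h : hom V T) (k : hom W V) :
    (forall W (k : hom W V), exists z, Q W (compm h k) z) ->
    forall W' (k' : hom W' W), exists z, Q W' (compm (compm h k) k') z.
  by move=> Rh W' k'; rewrite -comp_assoc.
exists (Sieve Rcomp); last by move=> V h /(_ V (idm V)); rewrite comp_idr.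
apply: (covering_trans cS) => U f /hS[q /PQ[Sf cSf hSf]].
apply: (covering_sub cSf) => V g Sg W k /=.
rewrite -comp_assoc; apply: hSf; exact: sieve_comp.
Qed.

End Locally.

(** * Words in the translations *)

Section Words.
Variables (C : category) (X : presheaf C) (mu : pmorph (prod_psh X X) X).
Variable hc : cancellative mu.

(** The pair [(true, x)] stands for [lambda_x] and [(false, x)] for
    [lambda_x^dagger]; unlike partial morphisms on slices, these codes
    restrict along the morphisms of the category. *)
Definition letter (T : C) : Type := (bool * X T)%type.

Definition res_letter (T U : C) (f : hom U T) (a : letter T) : letter U :=
  (a.1, res f a.2).

Definition letter_op (b : bool) : pmorph (prod_psh X X) X :=
  if b then mu else mu13 hc.

Definition acts (T : C) (a : letter T) (z y : X T) : Prop :=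
  insub_psh (graph (letter_op a.1)) ((a.2, z, y) : prod_psh (prod_psh X X) X T).

(** The head of the list is the innermost factor of the composition. *)
Fixpoint run (T : C) (w : seq (letter T)) (z y : X T) : Prop :=
  if w is a :: w' then exists2 v, acts a z v & run w' v y else z = y.

Definition translation (T : C) (a : letter T) :
    pmorph (restrict X T) (restrict X T) :=
  ltrans (letter_op a.1) a.2.

Lemma tildeX_translation (T : C) (a : letter T) : tildeX hc (translation a).
Proof. by case: a => -[] x; exists x; [left|right]. Qed.

Lemma translationP (T : C) phi : tildeX hc phi ->
  exists a : letter T, phi = translation a.
Proof. by case=> x [] ->; [exists (true, x)|exists (false, x)]. Qed.

Lemma graph_translation (T U : C) (a : letter T) (f : hom U T) (z y : X U) :
  insub_psh (graph (translation a))
    ((z, y) : prod_psh (restrict X T) (restrict X T) (slice_mk f)) <->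
  acts (res_letter f a) z y.
Proof.
have tr_pval (h : insub_psh (ltrans_dom (letter_op a.1) a.2)
                    (z : restrict X T (slice_mk f))) :
    pval (translation a) h = pval (letter_op a.1) h.
  by rewrite /pval /=; apply: pval_irr.
split=> -[h e]; apply: (ex_intro _ h).
- exact: etrans (esym (tr_pval h)) e.
- exact: etrans (tr_pval h) e.
Qed.

Lemma run_translation2 (T U : C) (a b : letter T) (f : hom U T)
    (z : restrict X T (slice_mk f)) :
  insub_psh (pdom (pmorph_comp (translation a) (translation b))) z ->
  exists y, run [:: res_letter f b; res_letter f a] z y.
Proof.
move=> [k1 k2]; exists (pval _ k2), (pval _ k1).
  by apply/graph_translation; exists k1.
by exists (pval _ k2) => //; apply/graph_translation; exists k2.
Qed.

Lemma res_letter_comp (T U V : C) (f : hom U T) (g : hom V U) (a : letter T) :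
  res_letter (compm f g) a = res_letter g (res_letter f a).
Proof. by rewrite /res_letter res_comp. Qed.

Lemma acts_res (T U : C) (f : hom U T) (a : letter T) (z y : X T) :
  acts a z y -> acts (res_letter f a) (res f z) (res f y).
Proof. exact: insub_res. Qed.

Lemma acts_fun (T : C) (a : letter T) (z y y' : X T) :
  acts a z y -> acts a z y' -> y = y'.
Proof. by move=> [h /= <-] [h' /= <-]; apply: pval_irr. Qed.

(** The two clauses of strong associativity are one statement about letters:
    a translation commutes with right multiplication by [z]. *)
Lemma acts_assoc (sa : strongly_associative hc) (T : C) (a : letter T)
    (q z r qz s t : X T) :
  acts a q r -> acts (true, q) z qz -> acts a qz s -> acts (true, r) z t ->
  s = t.
Proof.
case: a => -[] x [/= hq <-] [/= hqz <-] [/= hs <-] [/= ht <-].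
- exact: (@assoc_mu _ _ _ _ sa _ _ _ _ hqz hs hq ht).
- exact: (@assoc_mu13 _ _ _ _ sa _ _ _ _ hqz hs hq ht).
Qed.

Lemma run_cat (T : C) (w1 w2 : seq (letter T)) (z y : X T) :
  run (w1 ++ w2) z y -> exists2 v, run w1 z v & run w2 v y.
Proof.
elim: w1 z => [|a w1 IH] z /=; first by exists z.
by case=> u azu /IH[v uv vy]; exists v => //; exists u.
Qed.

Lemma graph_pmorph_comp (D : category) (Y : presheaf D) (psi phi : pmorph Y Y)
    (T : D) (z v y : Y T) :
  insub_psh (graph phi) ((z, v) : prod_psh Y Y T) ->
  insub_psh (graph psi) ((v, y) : prod_psh Y Y T) ->
  insub_psh (graph (pmorph_comp psi phi)) ((z, y) : prod_psh Y Y T).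
Proof.
move=> [/= h ev] [/= k <-]; subst v.
exists (ex_intro _ h k); rewrite {1}/pval /=; apply: pval_irr; exact: pval_irr.
Qed.

(** Concatenation of words absorbs the bracketing of compositions. *)
Lemma tildeX_inf_run (T : C) phi : tildeX_inf hc phi ->
  exists w : seq (letter T), forall U (f : hom U T) (z y : X U),
    run (map (res_letter f) w) z y ->
    insub_psh (graph phi)
      ((z, y) : prod_psh (restrict X T) (restrict X T) (slice_mk f)).
Proof.
elim=> {phi} [phi /translationP[a ->]|psi phi _ [w2 IH2] _ [w1 IH1]].
  by exists [:: a] => U f z y /= [v azv <-]; apply/graph_translation.
exists (w1 ++ w2) => U f z y; rewrite map_cat => /run_cat[v /IH1 zv /IH2 vy].
exact: (@graph_pmorph_comp _ (restrict X T) psi phi (slice_mk f) _ _ _ zv vy).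
Qed.

Lemma tildeX_inf_inhabited (T : C) (phi : pmorph (restrict X T) (restrict X T)) :
  tildeX_inf hc phi -> inhabited (X T).
Proof. by elim=> // {}phi [x _]; exists. Qed.

(** * Predicates holding on a large domain *)

(** [largely P] means that [P] holds on a finite intersection of domains of
    compositions of two translations by sections over [U].  These predicates
    form a filter; when [X U] is inhabited, large domain makes all the
    predicates in it locally satisfiable. *)
Definition largely (U : C) (P : forall V, hom V U -> X V -> Prop) : Prop :=
  exists (I : finType) (ab : I -> letter U * letter U),
    forall V (g : hom V U) z,
      (forall i, exists y,
         run [:: res_letter g (ab i).2; res_letter g (ab i).1] z y) ->
      P V g z.

Lemma largelyW (U : C) (P Q : forall V, hom V U -> X V -> Prop) :
  (forall V g z, P V g z -> Q V g z) -> largely P -> largely Q.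
Proof.
by move=> PQ [I [ab h]]; exists I, ab => V g z /h /PQ.
Qed.

Lemma largely_forall (U : C) (I : finType)
    (P : I -> forall V, hom V U -> X V -> Prop) :
  (forall i, largely (P i)) -> largely (fun V g z => forall i, P i V g z).
Proof.
move=> lP.
pose J i := cid (lP i); pose ab i := cid (projT2 (J i)).
exists {i : I & projT1 (J i)}, (fun u => projT1 (ab (tag u)) (tagged u)).
move=> V g z hz i; apply: (projT2 (ab i)) => j.
exact: (hz (Tagged (fun i => projT1 (J i)) j)).
Qed.

Lemma largelyI (U : C) (P Q : forall V, hom V U -> X V -> Prop) :
  largely P -> largely Q -> largely (fun V g z => P V g z /\ Q V g z).
Proof.
move=> lP lQ.
apply: largelyW (largely_forall (P := fun b : bool => if b then P else Q) _).
  by move=> V g z h; split; [apply: (h true)|apply: (h false)].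
by case.
Qed.

Lemma largely_acts2 (U : C) (a b : letter U) :
  largely (fun V g z => exists2 v, acts (res_letter g b) z v &
                          exists y, acts (res_letter g a) v y).
Proof.
exists unit, (fun=> (a, b)) => V g z /(_ tt)[y /= [v bzv [t avt _]]].
by exists v => //; exists t.
Qed.

(** The inductive step: if [q] runs through [l] then [q z] runs through one
    letter more, as the running value is the one reached from [q] times [z].
    The case [m = [::]] serves the words that are too short to be truncated. *)
Lemma largely_run (sa : strongly_associative hc) (U : C)
    (l m : seq (letter U)) (q r : X U) :
  run l q r -> size m <= 1 ->
  largely (fun V g z => exists2 v, acts (true, res g q) z v &
                          exists y, run (map (res_letter g) (l ++ m)) v y).
Proof.
elim: l q => [|a l IH] q /= lq sm.
- case: m sm => [|a [|//]] _.
    apply: largelyW (largely_acts2 (true, q) (true, q)) => V g z [v qzv _].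
    by exists v => //; exists v.
  apply: largelyW (largely_acts2 a (true, q)) => V g z [v qzv [y avy]].
  by exists v => //; exists y; exists y.
case: lq => q' aqq' /IH /(_ sm) IHq'.
apply: largelyW (largelyI (largely_acts2 a (true, q)) IHq').
move=> V g z [[v qzv [s avs]] [t q'zt [y ty]]].
exists v => //; exists y; exists s => //.
by rewrite (acts_assoc sa (acts_res g aqq') qzv avs q'zt).
Qed.

End Words.

(** * Large domain for words of any length *)

Section LargeDomain.
Variables (C : site) (X : presheaf C) (mu : pmorph (prod_psh X X) X).
Variables (hc : cancellative mu) (sa : strongly_associative hc).
Hypothesis ld : large_domain hc.

Lemma largely_locally (U : C) (P : forall V, hom V U -> X V -> Prop) :
  inhabited (X U) -> largely hc P -> locally P.
Proof.
move=> [x] lP.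
have [I [ab h]] := lP.
(* The extra pair makes the index type nonempty, as large domain requires. *)
pose ab' (u : option I) :=
  if u is Some i then ab i else ((true, x), (true, x)).
have cI : 0 < #|{: option I}| by rewrite card_option.
have [S cS hS] := ld cI
  (alpha := fun k => translation hc (ab' (enum_val k)).1)
  (beta := fun k => translation hc (ab' (enum_val k)).2)
  (fun k => tildeX_translation hc _) (fun k => tildeX_translation hc _).
exists S => // V g /hS[z hz]; exists z; apply: h => i.
by have := hz (enum_rank (Some i)); rewrite enum_rankK => /run_translation2.
Qed.

(** Truncating the words to the maximal length minus one removes outermost
    letters only, and at most one from each word, so that [largely_run] applies
    to the sections [q] obtained for the truncated words.  The section that runs
    through the words is then [q z] rather than [z]. *)
Lemma locally_runs (T : C) (n : nat) (I : finType) (w : I -> seq (letter X T)) :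
  inhabited (X T) -> (forall i, size (w i) <= n) ->
  locally (fun U f z => forall i, exists y,
             run hc (map (res_letter f) (w i)) z y).
Proof.
move=> neX; elim: n => [|n IH] in w *.
  move=> w0; apply: (largely_locally neX); exists void, (of_void _) => V g z _ i.
  by exists z; have := w0 i; rewrite leqn0 => /nilP->.
move=> wn; have /IH : forall i, size (take n (w i)) <= n.
  by move=> i; rewrite size_take_min geq_minl.
move/locally_bind; apply=> U f q hq.
have lw i : largely hc (fun V g z => exists2 v, acts hc (true, res g q) z v &
    exists y, run hc (map (res_letter (compm f g)) (w i)) v y).
  have [r qr] := hq i.
  have sm : size (map (res_letter f) (drop n (w i))) <= 1.
    by rewrite size_map size_drop leq_subLR addn1.
  apply: largelyW (largely_run sa qr sm) => V g z.
  rewrite -map_cat cat_take_drop -map_comp.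
  by rewrite (eq_map (fun a => res_letter_comp f g a)).
have lq := largely_acts2 hc (true, q) (true, q).
apply: locallyW (largely_locally _ (largelyI lq (largely_forall lw))).
- move=> V g z [[v qzv _] hz]; exists v => i.
  have [v' qzv' [y vy]] := hz i; exists y.
  by rewrite (acts_fun qzv qzv').
- by exists.
Qed.

End LargeDomain.

Theorem mainTheorem7 (C : site) (X : presheaf C)
    (mu : pmorph (prod_psh X X) X) (gc : group_chunk mu)
    (T : C) (n : nat) (n_gt0 : 0 < n)
    (phi : 'I_n -> pmorph (restrict X T) (restrict X T))
    (phiP : forall i, tildeX_inf (gc_cancellative gc) (phi i)) :
  locally_nontrivial (sub_bigcap (fun i => pdom (phi i))).
Proof.
have neX := tildeX_inf_inhabited (phiP (Ordinal n_gt0)).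
have [w hw] := choice (fun i => tildeX_inf_run (phiP i)).
have wn i : size (w i) <= \max_i size (w i) by exact: leq_bigmax.
have [S cS hS] := locally_runs (gc_assoc gc) (@gc_large _ _ _ gc) neX wn.
exists S => // U f /hS[z hz]; exists z => i.
by have [y /hw[h _]] := hz i.
Qed.
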